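(* Let $0<\alpha<1$ and $d_1,d_2,d_\alpha>0$. Consider the initial-boundary value problem for the Riesz space fractional turbulent diffusion equation $$\frac{\partial u}{\partial t}=-d_1\frac{\partial u}{\partial x}+d_2\frac{\partial^2u}{\partial x^2}+d_\alpha\frac{\partial^\alpha u}{\partial|x|^\alpha}+s(x,t),\quad x\in(a,b),\ t\in(0,T],$$ with $u(x,0)=\varphi(x)$ for $x\in[a,b]$ and $u(a,t)=u(b,t)=0$, and the numerical scheme $$\left(\frac{d_2}{h^2}+\frac{d_1}{2h}\right)u_{j-1}^{k+1}-\left(\frac2\tau+\frac{2d_2}{h^2}\right)u_j^{k+1}+\left(\frac{d_2}{h^2}-\frac{d_1}{2h}\right)u_{j+1}^{k+1}-\nu\left[\sum_{\ell=0}^{j}\varpi_{2,\ell}^{(\alpha)}u_{j-\ell}^{k+1}+\sum_{\ell=0}^{M-j}\varpi_{2,\ell}^{(\alpha)}u_{j+\ell}^{k+1}\right]$$ $$=-\left(\frac{d_2}{h^2}+\frac{d_1}{2h}\right)u_{j-1}^{k}-\left(\frac2\tau-\frac{2d_2}{h^2}\right)u_j^{k}-\left(\frac{d_2}{h^2}-\frac{d_1}{2h}\right)u_{j+1}^{k}+\nu\left[\sum_{\ell=0}^{j}\varpi_{2,\ell}^{(\alpha)}u_{j-\ell}^{k}+\sum_{\ell=0}^{M-j}\varpi_{2,\ell}^{(\alpha)}u_{j+\ell}^{k}\right]-2s_j^{k+\frac12}$$ for $j=1,\dots,M-1$, $k=0,1,\dots,N-1$, where $\nu=\dfrac{d_\alpha}{2\cos(\pi\alpha/2)h^\alpha}$,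 $u_j^0=\varphi(x_j)$, and $u_0^k=u_M^k=0$. This scheme is unconditionally stable and convergent with order $\mathcal O(\tau^2+h^2)$.
   Context: Grid: $T>0$, $\tau=T/N$, $t_k=k\tau$, $h=(b-a)/M$, $x_j=a+jh$; $u_j^k$ is the numerical approximation of $u(x_j,t_k)$ and $s_j^{k+1/2}=s(x_j,t_k+\tau/2)$. Riesz derivative ($0<\alpha<1$): $$\frac{\partial^\alpha u(x,t)}{\partial|x|^\alpha}=-\frac{1}{2\cos(\pi\alpha/2)}\left({}_{RL}D_{a,x}^\alpha+{}_{RL}D_{x,b}^\alpha\right)u(x,t),$$ where ${}_{RL}D_{a,x}^\alpha f(x)=\frac{1}{\Gamma(1-\alpha)}\frac{d}{dx}\int_a^x(x-\xi)^{-\alpha}f(\xi)\,d\xi$ and ${}_{RL}D_{x,b}^\alpha f(x)=\frac{-1}{\Gamma(1-\alpha)}\frac{d}{dx}\int_x^b(\xi-x)^{-\alpha}f(\xi)\,d\xi$. Coefficients: $\left(\frac32-2z+\frac12z^2\right)^\alpha=\sum_{\ell\ge0}\varpi_{2,\ell}^{(\alpha)}z^\ell$ (branch positive at $z=0$). Unconditional stability (Fourier/von Neumann sense): the solution is extended by zero to the whole real line, so the error $\mathcal E_j^k$ satisfies the scheme with $s=0$ and with both sums over $\ell$ extended to $\infty$. For all $\tau,h>0$ and all $\theta\in[-\pi,\pi]$, every mode $\mathcal E_j^k=\xi^k e^{ij\theta}$ ($i=\sqrt{-1}$ in the exponent) solving this error equation has amplification factor $\xi=\xi(\theta)$ with $|\xi(\theta)|\le1$.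 Convergence of order $\mathcal O(\tau^2+h^2)$: suppose the exact solution $u$, extended by zero outside $[a,b]$, is regular enough that the following hold uniformly on the grid: the Crank–Nicolson time discretization at $t_{k+1/2}$ has error $\mathcal O(\tau^2)$; the central differences $\frac{u(x_{j+1},t)-u(x_{j-1},t)}{2h}$ and $\frac{u(x_{j+1},t)-2u(x_j,t)+u(x_{j-1},t)}{h^2}$ approximate $u_x$ and $u_{xx}$ with error $\mathcal O(h^2)$; and $$\frac{\partial^\alpha u}{\partial|x|^\alpha}(x,t)=-\frac{1}{2\cos(\pi\alpha/2)h^\alpha}\sum_{\ell=0}^\infty\varpi_{2,\ell}^{(\alpha)}\left(u(x-\ell h,t)+u(x+\ell h,t)\right)+\mathcal O(h^2).$$ Then there is a constant $C$ independent of $\tau,h$ such that $\left(h\sum_{j=1}^{M-1}|u(x_j,t_k)-u_j^k|^2\right)^{1/2}\le C(\tau^2+h^2)$ for all $0\le k\le N$. *)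

(* Defs.v *)
From Stdlib Require Import Reals ZArith.
From Coquelicot Require Import Coquelicot.

Open Scope R_scope.

(** * Riesz fractional derivative *)

Definition Gamma (z : R) : R :=
  RInt_gen (fun t => Rpower t (z - 1) * exp (- t))
           (at_right 0) (Rbar_locally p_infty).

(* The kernels are singular at the moving endpoint [x], so the integrals are
   improper there. *)
Definition left_kernel (alpha : R) (f : R -> R) (x xi : R) : R :=
  Rpower (x - xi) (- alpha) * f xi.

Definition right_kernel (alpha : R) (f : R -> R) (x xi : R) : R :=
  Rpower (xi - x) (- alpha) * f xi.

Definition left_int (alpha a : R) (f : R -> R) (x : R) : R :=
  RInt_gen (left_kernel alpha f x) (at_point a) (at_left x).

Definition right_int (alpha b : R) (f : R -> R) (x : R) : R :=
  RInt_gen (right_kernel alpha f x) (at_right x) (at_point b).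

Definition RL_left (alpha a : R) (f : R -> R) (x : R) : R :=
  1 / Gamma (1 - alpha) * Derive (left_int alpha a f) x.

Definition RL_right (alpha b : R) (f : R -> R) (x : R) : R :=
  - 1 / Gamma (1 - alpha) * Derive (right_int alpha b f) x.

Definition riesz (alpha a b : R) (f : R -> R) (x : R) : R :=
  - (1 / (2 * cos (PI * alpha / 2))) *
  (RL_left alpha a f x + RL_right alpha b f x).

(* [RInt_gen] and [Derive] are total: this says that their values in
   [riesz alpha a b f x] are genuine. *)
Definition ex_riesz (alpha a b : R) (f : R -> R) (x : R) : Prop :=
  locally x (fun y =>
    ex_RInt_gen (left_kernel alpha f y) (at_point a) (at_left y) /\
    ex_RInt_gen (right_kernel alpha f y) (at_right y) (at_point b)) /\
  ex_derive (left_int alpha a f) x /\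
  ex_derive (right_int alpha b f) x.

(** * Coefficients of the second-order approximation *)

(* Near [z = 0] the base is positive, so [Rpower] is the branch of the power
   that is positive at [0]; the identity near [0] determines [varpi]. *)
Definition generating_coeffs (alpha : R) (varpi : nat -> R) : Prop :=
  locally 0 (fun z : R =>
    is_pseries varpi z (Rpower (3 / 2 - 2 * z + 1 / 2 * z ^ 2) alpha)).

(** * The initial-boundary value problem *)

(* Derivative relative to a set [D]: one-sided at an endpoint of an interval. *)
Definition is_derive_within (D : R -> Prop) (f : R -> R) (t l : R) : Prop :=
  filterlim (fun r => (f r - f t) / (r - t)) (within D (locally' t)) (locally l).

Definition space_differentiable (alpha a b : R) (f : R -> R) : Prop :=
  forall x, a < x < b ->
    ex_derive f x /\ ex_derive_n f 2 x /\ ex_riesz alpha a b f x.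

Definition space_operator (alpha d1 d2 dalpha a b : R) (f : R -> R) (x : R) : R :=
  - d1 * Derive f x + d2 * Derive_n f 2 x + dalpha * riesz alpha a b f x.

Definition solves_ibvp (alpha d1 d2 dalpha a b T : R) (s : R -> R -> R)
    (phi : R -> R) (u : R -> R -> R) : Prop :=
  (forall t, 0 < t <= T ->
     space_differentiable alpha a b (fun y => u y t) /\
     forall x, a < x < b ->
       is_derive_within (fun r => 0 <= r <= T) (u x) t
         (space_operator alpha d1 d2 dalpha a b (fun y => u y t) x + s x t)) /\
  (forall x, a <= x <= b -> u x 0 = phi x) /\
  (forall t, 0 <= t <= T -> u a t = 0 /\ u b t = 0).

(** * The numerical scheme *)

Definition nu (alpha dalpha h : R) : R :=
  dalpha / (2 * cos (PI * alpha / 2) * Rpower h alpha).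

Definition step (L : R) (n : nat) : R := L / INR n.

(* [U j k] is the numerical value at the node [(x_j, t_k)]. *)
Definition solves_scheme (alpha d1 d2 dalpha a b T : R) (varpi : nat -> R)
    (s : R -> R -> R) (phi : R -> R) (M N : nat) (U : nat -> nat -> R) : Prop :=
  let h := step (b - a) M in
  let tau := step T N in
  let nu := nu alpha dalpha h in
  let x (j : nat) := a + INR j * h in
  let t (k : nat) := INR k * tau in
  let riesz_sums (j k : nat) : R :=
    sum_n (fun l => varpi l * U (j - l)%nat k) j +
    sum_n (fun l => varpi l * U (j + l)%nat k) (M - j) in
  (forall j k : nat, (1 <= j <= M - 1)%nat -> (k < N)%nat ->
     (d2 / h ^ 2 + d1 / (2 * h)) * U (j - 1)%nat (k + 1)%nat
     - (2 / tau + 2 * d2 / h ^ 2) * U j (k + 1)%nat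
     + (d2 / h ^ 2 - d1 / (2 * h)) * U (j + 1)%nat (k + 1)%nat
     - nu * riesz_sums j (k + 1)%nat
     = - (d2 / h ^ 2 + d1 / (2 * h)) * U (j - 1)%nat k
       - (2 / tau - 2 * d2 / h ^ 2) * U j k
       - (d2 / h ^ 2 - d1 / (2 * h)) * U (j + 1)%nat k
       + nu * riesz_sums j k
       - 2 * s (x j) (t k + tau / 2)) /\
  (forall j : nat, (j <= M)%nat -> U j 0%nat = phi (x j)) /\
  (forall k : nat, (k <= N)%nat -> U 0%nat k = 0 /\ U M k = 0).

(** * Von Neumann stability *)

(* The scheme on the whole line with [s = 0] and infinite sums; [SL j k] and
   [SR j k] are the values of the two sums, which are required to converge. *)
Definition solves_error_equation (alpha d1 d2 dalpha : R) (varpi : nat -> R)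
    (tau h : R) (E : Z -> nat -> C) : Prop :=
  let nu := nu alpha dalpha h in
  exists SL SR : Z -> nat -> C,
    (forall j k,
       is_series (fun l : nat => (RtoC (varpi l) * E (j - Z.of_nat l)%Z k)%C)
                 (SL j k) /\
       is_series (fun l : nat => (RtoC (varpi l) * E (j + Z.of_nat l)%Z k)%C)
                 (SR j k)) /\
    forall (j : Z) (k : nat),
      (RtoC (d2 / h ^ 2 + d1 / (2 * h)) * E (j - 1)%Z (k + 1)%nat
       - RtoC (2 / tau + 2 * d2 / h ^ 2) * E j (k + 1)%nat
       + RtoC (d2 / h ^ 2 - d1 / (2 * h)) * E (j + 1)%Z (k + 1)%nat
       - RtoC nu * (SL j (k + 1)%nat + SR j (k + 1)%nat)
       = - RtoC (d2 / h ^ 2 + d1 / (2 * h)) * E (j - 1)%Z k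
         - RtoC (2 / tau - 2 * d2 / h ^ 2) * E j k
         - RtoC (d2 / h ^ 2 - d1 / (2 * h)) * E (j + 1)%Z k
         + RtoC nu * (SL j k + SR j k))%C.

(* [xi ^ k * exp (i j theta)] *)
Definition fourier_mode (xi : C) (theta : R) (j : Z) (k : nat) : C :=
  (xi ^ k * (cos (IZR j * theta), sin (IZR j * theta)))%C.

Definition unconditionally_stable (alpha d1 d2 dalpha : R) (varpi : nat -> R)
    : Prop :=
  forall (tau h theta : R) (xi : C),
    0 < tau -> 0 < h -> - PI <= theta <= PI ->
    solves_error_equation alpha d1 d2 dalpha varpi tau h (fourier_mode xi theta) ->
    Cmod xi <= 1.

(** * Convergence *)

Definition zero_ext (a b : R) (f : R -> R) (x : R) : R :=
  if Rle_dec a x then if Rle_dec x b then f x else 0 else 0.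

(* Uniform orders on all grids: one constant [K] serves every [M], [N], [j], [k].
   The zero extension matters only in the infinite sum: the other quantities
   involve [u] on [[a, b]] alone.  The Crank-Nicolson error is that of the time
   discretization of [u_t - L u] at [t_{k+1/2}], with [L] the [space_operator].
   The first clause completes [solves_ibvp], which has no spatial derivatives at [t = 0]. *)
Definition consistent (alpha d1 d2 dalpha a b T : R) (varpi : nat -> R)
    (u : R -> R -> R) : Prop :=
  let L (t x : R) := space_operator alpha d1 d2 dalpha a b (fun y => u y t) x in
  space_differentiable alpha a b (fun y => u y 0) /\
  exists K : R, forall M N : nat, (1 <= M)%nat -> (1 <= N)%nat ->
    let h := step (b - a) M in
    let tau := step T N in
    let x (j : nat) := a + INR j * h in
    let t (k : nat) := INR k * tau in
    (forall j k : nat, (1 <= j <= M - 1)%nat -> (k < N)%nat ->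
       let tmid := t k + tau / 2 in
       Rabs (((u (x j) (t (k + 1)%nat) - u (x j) (t k)) / tau
              - (L (t (k + 1)%nat) (x j) + L (t k) (x j)) / 2)
             - (Derive (u (x j)) tmid - L tmid (x j)))
       <= K * tau ^ 2) /\
    (forall j k : nat, (1 <= j <= M - 1)%nat -> (k <= N)%nat ->
       let f := fun y => u y (t k) in
       let g := zero_ext a b f in
       Rabs ((f (x (j + 1)%nat) - f (x (j - 1)%nat)) / (2 * h)
             - Derive f (x j)) <= K * h ^ 2 /\
       Rabs ((f (x (j + 1)%nat) - 2 * f (x j) + f (x (j - 1)%nat)) / h ^ 2
             - Derive_n f 2 (x j)) <= K * h ^ 2 /\
       Rabs (riesz alpha a b f (x j)
             - - (1 / (2 * cos (PI * alpha / 2) * Rpower h alpha)) *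
               Series (fun l => varpi l *
                 (g (x j - INR l * h) + g (x j + INR l * h))))
       <= K * h ^ 2).

Definition second_order_convergent (alpha d1 d2 dalpha a b T : R)
    (varpi : nat -> R) (s : R -> R -> R) (phi : R -> R) (u : R -> R -> R)
    : Prop :=
  exists C : R, forall (M N : nat) (U : nat -> nat -> R),
    (1 <= M)%nat -> (1 <= N)%nat ->
    solves_scheme alpha d1 d2 dalpha a b T varpi s phi M N U ->
    let h := step (b - a) M in
    let tau := step T N in
    forall k : nat, (k <= N)%nat ->
      sqrt (h * sum_n_m (fun j =>
                  Rabs (u (a + INR j * h) (INR k * tau) - U j k) ^ 2) 1 (M - 1))
      <= C * (tau ^ 2 + h ^ 2).

(* Main.v *)
Require Import Defs.
From Stdlib Require Import Reals ZArith Lra Lia.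
From Coquelicot Require Import Coquelicot.

Open Scope R_scope.

(** Stability and convergence both rest on one fact: the symmetrized Toeplitz
    operator with symbol [2 * sum_l varpi_l cos (l theta)], which discretizes
    [- riesz] up to a positive factor, is positive semidefinite.  The other
    spatial terms are harmless, the central first difference being
    skew-symmetric and the second difference negative semidefinite, so the
    semidiscrete operator is dissipative and Crank-Nicolson is a Cayley
    transform, which turns dissipative operators into contractions.

    Positivity could be read off the symbol
    [Re ((3/2 - 2 w + w^2/2)^alpha) >= 0] for [|w| = 1], but that needs complex
    powers and Fourier analysis.  The proof is instead real and finite.  The
    base [P] of the generating function [g = P^alpha] gives the equation
    [P g' = alpha (z - 2) g], hence the three-term recurrence
    [generating_coeffs_rec].  It shows that [varpi_l <= 0] for all [l >= 4]
    ([generating_coeffs_tail]) and, after summation, that the partial sums of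
    [varpi] are nonnegative from index 4 on.  If all [varpi_l] with [l >= 1]
    were nonpositive, diagonal dominance would finish the proof; but [varpi_2]
    and [varpi_3] are positive when [alpha] is close to 1.  Then
    [- varpi_1] absorbs them, because
    [1 - cos (l theta) <= l^2 (1 - cos theta)] and
    [varpi_1 + 4 varpi_2^+ + 9 varpi_3^+ <= 0].  This is
    [generating_coeffs_weighted_sum], stated for any sequence [r] that behaves
    like [cos (l theta)] in these respects.  It is used twice: with
    [r_l = cos (l theta)] for the amplification factor
    ([mode_unconditionally_stable]), and with the autocorrelation
    [r_l = sum_j p_j p_(j+l)] of a grid function, for which
    [2 * sum_l varpi_l r_l] is the quadratic form of the discrete Riesz operator
    ([riesz_sums_nonneg]).

    Convergence is then an energy estimate.  The error
    [w^k = u (., t_k) - U^k] satisfies the scheme with the truncation error,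
    of size [K (tau^2 + h^2)], as right-hand side ([truncation_error]).  Testing
    the scheme with [w^(k+1) + w^k] and using dissipativity bounds the growth of
    the discrete L2 norm in one step by [tau] times the truncation error
    ([crank_nicolson_step_le]); there are at most [T / tau] steps. *)

(** * Signs of the coefficients *)

Lemma CV_radius_pos_of_locally (c : nat -> R) :
  locally 0 (fun z : R => ex_pseries c z) -> Rbar_lt 0 (CV_radius c).
Proof.
intros [d Hd].
assert (Hpos := cond_pos d).
assert (Hz : ex_pseries c (d / 2)).
{ apply Hd. change (Rabs (d / 2 - 0) < d). rewrite Rminus_0_r, Rabs_pos_eq; lra. }
apply Rbar_lt_le_trans with (Finite (d / 2)); [simpl; lra|].
apply Rbar_not_lt_le; intros Hlt.
apply (CV_disk_outside c (d / 2)).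
- rewrite Rabs_pos_eq; [exact Hlt|lra].
- apply ex_series_lim_0.
  apply ex_series_ext with (2 := Hz); intros n.
  rewrite pow_n_pow. apply Rmult_comm.
Qed.

Lemma pseries_locally_zero (c : nat -> R) (n : nat) :
  locally 0 (fun z : R => is_pseries c z 0) -> c n = 0.
Proof.
intros Hc.
assert (Hzero : forall z : R, is_pseries (fun _ => 0) z 0).
{ intros z. apply (is_series_ext (fun _ => 0)).
  - intros k. change (0 = pow_n z k * 0). ring.
  - apply filterlim_ext with (fun _ : nat => 0); [|apply filterlim_const].
    intros k. rewrite sum_n_const. ring. }
apply (PSeries_ext_recip c (fun _ => 0)).
- apply CV_radius_pos_of_locally.
  apply filter_imp with (2 := Hc); intros z Hz; exists 0; exact Hz.
- apply CV_radius_pos_of_locally, filter_forall; intros z; exists 0; apply Hzero.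
- apply filter_imp with (2 := Hc); intros z Hz.
  rewrite (is_pseries_unique _ _ _ Hz). symmetry.
  apply is_pseries_unique, Hzero.
Qed.

Lemma generating_coeffs_0 (alpha : R) (v : nat -> R) :
  generating_coeffs alpha v -> 0 < v 0%nat.
Proof.
intros Hv.
assert (H := is_pseries_unique _ _ _ (locally_singleton _ _ Hv)).
rewrite PSeries_0 in H. rewrite H. apply exp_pos.
Qed.

Lemma generating_coeffs_ode (alpha : R) (v : nat -> R) :
  generating_coeffs alpha v ->
  locally 0 (fun z : R =>
    is_pseries v z (PSeries v z) /\
    is_pseries (PS_derive v) z (Derive (PSeries v) z) /\
    (3 / 2 - 2 * z + 1 / 2 * z ^ 2) * Derive (PSeries v) z
    = alpha * (z - 2) * PSeries v z).
Proof.
intros Hv.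
assert (Hr : Rbar_lt 0 (CV_radius v)).
{ apply CV_radius_pos_of_locally.
  apply filter_imp with (2 := Hv); intros z Hz; eexists; exact Hz. }
assert (Hin : locally 0 (fun z : R => Rbar_lt (Rabs z) (CV_radius v))).
{ destruct (CV_radius v) as [r| |]; simpl in Hr; [|apply filter_forall; easy|easy].
  exists (mkposreal r Hr); intros z Hz.
  change (Rabs (z - 0) < r) in Hz. rewrite Rminus_0_r in Hz. exact Hz. }
assert (Hsmall : locally 0 (fun z : R => Rabs z < 1 / 2)).
{ assert (H2 : 0 < 1 / 2) by lra.
  exists (mkposreal _ H2); intros z Hz.
  change (Rabs (z - 0) < 1 / 2) in Hz. rewrite Rminus_0_r in Hz. exact Hz. }
assert (Hl := locally_locally _ _ Hv).
generalize (filter_and _ _ Hin (filter_and _ _ Hsmall Hl)).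
apply filter_imp; intros z (Hz1 & Hz2 & Hz3).
apply Rabs_def2 in Hz2.
assert (HP : 0 < 3 / 2 - 2 * z + 1 / 2 * z ^ 2) by nra.
split; [apply PSeries_correct, CV_radius_inside, Hz1|].
split; [apply is_pseries_derive, Hz1|].
rewrite (Derive_ext_loc _ (fun z => Rpower (3 / 2 - 2 * z + 1 / 2 * z ^ 2) alpha)).
2:{ apply filter_imp with (2 := Hz3); intros y Hy. apply is_pseries_unique, Hy. }
rewrite (is_pseries_unique _ _ _ (locally_singleton _ _ Hz3)).
unfold Rpower.
erewrite is_derive_unique.
2:{ auto_derive; [|reflexivity]. simpl in HP |- *. lra. }
replace (3 / 2 + - (2 * z) + 1 / 2 * (z * (z * 1)))
  with (3 / 2 - 2 * z + 1 / 2 * z ^ 2) by (simpl; ring).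
set (P := 3 / 2 - 2 * z + 1 / 2 * z ^ 2) in *.
set (E := exp _). field. lra.
Qed.

(** Comparing coefficients in [P g' = alpha (z - 2) g]. *)
Lemma generating_coeffs_rec (alpha : R) (v : nat -> R) :
  generating_coeffs alpha v ->
  3 * v 1%nat = - 4 * alpha * v 0%nat /\
  forall n : nat,
    3 * (INR n + 2) * v (S (S n))
    = 4 * (INR n + 1 - alpha) * v (S n) - (INR n - 2 * alpha) * v n.
Proof.
intros Hv.
assert (Hrec : forall n : nat, PS_plus
  (PS_plus (PS_scal (3 / 2) (PS_derive v))
     (PS_plus (PS_scal (- 2) (PS_incr_1 (PS_derive v)))
       (PS_scal (1 / 2) (PS_incr_1 (PS_incr_1 (PS_derive v))))))
  (PS_plus (PS_scal (- alpha) (PS_incr_1 v)) (PS_scal (2 * alpha) v)) n = 0).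
{ intros n; apply pseries_locally_zero.
apply filter_imp with (2 := generating_coeffs_ode _ _ Hv).
  intros z (H1 & H2 & H3).
  assert (Hc : forall c : R, mult z c = mult c z) by (intros; apply Rmult_comm).
  evar_last.
  - apply is_pseries_plus; [apply is_pseries_plus; [|apply is_pseries_plus]|apply is_pseries_plus];
      (apply is_pseries_scal; [apply Hc|]).
    + exact H2.
    + apply is_pseries_incr_1, H2.
    + apply is_pseries_incr_1, is_pseries_incr_1, H2.
    + apply is_pseries_incr_1, H1.
    + exact H1.
  - unfold plus, scal; simpl. unfold mult; simpl.
    simpl in H3. lra. }
unfold PS_plus, PS_scal, PS_incr_1, PS_derive, plus, scal, zero in Hrec;
  simpl in Hrec; unfold mult in Hrec; simpl in Hrec.
split; [|intros n].
- specialize (Hrec 0%nat). simpl in Hrec. lra.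
- specialize (Hrec (S n)). destruct n as [|n]; [simpl in *; lra|].
  rewrite !S_INR in *.
  destruct n; simpl in *; lra.
Qed.

Lemma generating_coeffs_small (alpha : R) (v : nat -> R) :
  generating_coeffs alpha v ->
  v 1%nat = - (4 / 3) * alpha * v 0%nat /\
  v 2%nat = alpha * (8 * alpha - 5) / 9 * v 0%nat /\
  v 3%nat = alpha * (1 - alpha) * (64 * alpha - 56) / 162 * v 0%nat /\
  v 4%nat = - (alpha * (1 - alpha) * (492 - 704 * alpha + 256 * alpha ^ 2) / 1944
            * v 0%nat).
Proof.
intros Hv.
destruct (generating_coeffs_rec alpha v Hv) as [H1 Hrec].
assert (H2 := Hrec 0%nat). assert (H3 := Hrec 1%nat). assert (H4 := Hrec 2%nat).
simpl in H2, H3, H4.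
assert (E1 : v 1%nat = - (4 / 3) * alpha * v 0%nat) by lra.
rewrite E1 in *.
assert (E2 : v 2%nat = alpha * (8 * alpha - 5) / 9 * v 0%nat) by lra.
rewrite E2 in *.
assert (E3 : v 3%nat = alpha * (1 - alpha) * (64 * alpha - 56) / 162 * v 0%nat) by lra.
rewrite E3 in *.
repeat split; lra.
Qed.

(** The characteristic roots of the limiting recurrence are 1 and 1/3, so the
    bound [|v (S n)| >= |v n| / 3] persists once it holds at one place; this is what
    propagates negativity.  It can
    only be started at index 4, since [v 3 > 0] for [alpha > 7/8]. *)
Lemma generating_coeffs_tail (alpha : R) (v : nat -> R) :
  0 < alpha < 1 -> generating_coeffs alpha v ->
  forall n : nat, (4 <= n)%nat -> v n <= 0 /\ v (S n) <= v n / 3.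
Proof.
intros Ha Hv.
destruct (generating_coeffs_rec alpha v Hv) as [_ Hrec].
destruct (generating_coeffs_small alpha v Hv) as (_ & _ & E3 & E4).
assert (H0 := generating_coeffs_0 alpha v Hv).
assert (Hw : 0 < alpha * (1 - alpha) * v 0%nat)
  by (apply Rmult_lt_0_compat; [nra|exact H0]).
assert (Hstep : forall n : nat, (3 <= n)%nat ->
  v (S n) <= 0 -> v (S n) <= v n / 3 -> v (S (S n)) <= v (S n) / 3).
{ intros n Hn Hneg Hratio. specialize (Hrec n).
  apply le_INR in Hn. simpl in Hn.
  (* [v n >= 3 * v (S n)] is used with the nonnegative weight [n - 2 alpha]. *)
  apply Rmult_le_reg_l with (3 * (INR n + 2)); [lra|].
  rewrite Hrec. nra. }
(* Both bounds come down to quadratics in [alpha] with negative discriminant. *)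
assert (H4 : v 4%nat <= 0 /\ v 4%nat <= v 3%nat / 3).
{ rewrite E3, E4.
  assert (Hq : 0 <= 492 - 704 * alpha + 256 * alpha ^ 2) by nra.
  assert (Hq' : 0 <= 268 - 448 * alpha + 256 * alpha ^ 2) by nra.
  apply (Rmult_le_pos _ _ (Rlt_le _ _ Hw)) in Hq, Hq'.
  split; lra. }
intros n Hn. induction Hn as [|n Hn IH].
- destruct H4; split; [|apply Hstep]; auto.
- destruct IH as [IH1 IH2].
  split; [lra|apply Hstep; [lia|lra|exact IH2]].
Qed.

(** Summing the recurrence telescopes, because [3 - 4 + 1 = 0]: the base vanishes
    at [z = 1].  The ratio bound of [generating_coeffs_tail] makes the right-hand
    side nonnegative for [n >= 4]. *)
Lemma generating_coeffs_partial_sum (alpha : R) (v : nat -> R) :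
  generating_coeffs alpha v ->
  forall n : nat,
    2 * alpha * sum_n v n = (INR n - 2 * alpha) * v n - 3 * (INR n + 1) * v (S n).
Proof.
intros Hv.
destruct (generating_coeffs_rec alpha v Hv) as [H1 Hrec].
induction n as [|n IH].
- rewrite sum_O. simpl. lra.
- rewrite sum_Sn. change plus with Rplus.
  rewrite Rmult_plus_distr_l, IH, S_INR. specialize (Hrec n). lra.
Qed.

(** Write the sum as [r 0 * sum v - sum v_l (r 0 - r l)].  The first term and
    those with [l >= 4] are nonnegative; the hypotheses on [r 2] and [r 3] compare
    the possibly negative terms with the one for [l = 1], which dominates. *)
Lemma generating_coeffs_weighted_sum (alpha : R) (v r : nat -> R) :
  0 < alpha < 1 -> generating_coeffs alpha v ->
  0 <= r 0%nat -> (forall l, r l <= r 0%nat) ->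
  r 0%nat - r 2%nat <= 4 * (r 0%nat - r 1%nat) ->
  r 0%nat - r 3%nat <= 9 * (r 0%nat - r 1%nat) ->
  forall n : nat, (4 <= n)%nat -> 0 <= sum_n (fun l => v l * r l) n.
Proof.
intros Ha Hv Hr0 Hr Hr2 Hr3 n Hn.
assert (Htail := generating_coeffs_tail alpha v Ha Hv).
assert (Hsum : 0 <= sum_n v n).
{ assert (E := generating_coeffs_partial_sum alpha v Hv n).
  destruct (Htail n Hn) as [Hneg Hratio].
  assert (HI := pos_INR n).
  apply Rmult_le_reg_l with (2 * alpha); [lra|]. rewrite E. nra. }
assert (Hhead : r 0%nat * sum_n v n - v 1%nat * (r 0%nat - r 1%nat)
  - v 2%nat * (r 0%nat - r 2%nat) - v 3%nat * (r 0%nat - r 3%nat)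
  <= sum_n (fun l => v l * r l) n).
{ clear Hsum. induction Hn as [|n Hn IH].
  - rewrite !sum_Sn, !sum_O. change plus with Rplus.
    assert (H := Htail 4%nat (le_n _)). specialize (Hr 4%nat). nra.
  - rewrite !sum_Sn. change plus with Rplus.
    assert (H := Htail (S n) (le_S _ _ Hn)). specialize (Hr (S n)). nra. }
destruct (generating_coeffs_small alpha v Hv) as (E1 & E2 & E3 & _).
assert (H0 := generating_coeffs_0 alpha v Hv).
assert (Hav : 0 < alpha * v 0%nat) by nra.
assert (Hw : 0 < alpha * (1 - alpha) * v 0%nat) by nra.
assert (C2 : v 1%nat + 4 * v 2%nat <= 0) by (rewrite E1, E2; nra).
assert (C3 : v 1%nat + 9 * v 3%nat <= 0).
{ rewrite E1, E3. nra. }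
assert (C23 : v 1%nat + 4 * v 2%nat + 9 * v 3%nat <= 0).
{ rewrite E1, E2, E3. nra. }
assert (C1 : v 1%nat <= 0) by (rewrite E1; lra).
assert (D1 := Hr 1%nat). assert (D2 := Hr 2%nat). assert (D3 := Hr 3%nat).
assert (Hp : 0 <= r 0%nat * sum_n v n) by (apply Rmult_le_pos; assumption).
(* [C1], [C2], [C3] and [C23] cover the four sign patterns of [v 2] and [v 3]. *)
destruct (Rle_dec (v 2%nat) 0); destruct (Rle_dec (v 3%nat) 0); nra.
Qed.

(** * Von Neumann stability *)

Lemma cos_3a (x : R) : cos (3 * x) = 4 * cos x ^ 3 - 3 * cos x.
Proof.
replace (3 * x) with (2 * x + x) by ring.
rewrite cos_plus, cos_2a_cos, sin_2a.
assert (H := sin2_cos2 x). unfold Rsqr in H.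
replace (2 * sin x * cos x * sin x) with (2 * (sin x * sin x) * cos x) by ring.
replace (sin x * sin x) with (1 - cos x * cos x) by lra. ring.
Qed.

Lemma generating_coeffs_cos_sum (alpha : R) (v : nat -> R) (theta : R) :
  0 < alpha < 1 -> generating_coeffs alpha v ->
  forall n : nat, (4 <= n)%nat -> 0 <= sum_n (fun l => v l * cos (INR l * theta)) n.
Proof.
intros Ha Hv n Hn.
assert (Hc := COS_bound theta).
apply (generating_coeffs_weighted_sum alpha v (fun l => cos (INR l * theta))); auto.
- rewrite Rmult_0_l, cos_0. lra.
- intros l. rewrite Rmult_0_l, cos_0. apply COS_bound.
- rewrite Rmult_0_l, cos_0. simpl (INR 1). replace (INR 2) with 2 by (simpl; ring).
  rewrite Rmult_1_l, cos_2a_cos. nra.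
- rewrite Rmult_0_l, cos_0. simpl (INR 1). replace (INR 3) with 3 by (simpl; ring).
  rewrite Rmult_1_l, cos_3a.
  assert (H := Rmult_le_pos (cos theta + 2) ((1 - cos theta) ^ 2)
    ltac:(lra) (pow2_ge_0 _)).
  lra.
Qed.

Lemma is_series_C_components (a : nat -> C) (l : C) :
  is_series a l ->
  is_lim_seq (sum_n (fun k => fst (a k))) (fst l) /\
  is_lim_seq (sum_n (fun k => snd (a k))) (snd l).
Proof.
intros H.
assert (Hfst : forall n, fst (sum_n a n) = sum_n (fun k => fst (a k)) n).
{ induction n as [|n IH]; [now rewrite !sum_O|]. rewrite !sum_Sn, <- IH. reflexivity. }
assert (Hsnd : forall n, snd (sum_n a n) = sum_n (fun k => snd (a k)) n).
{ induction n as [|n IH]; [now rewrite !sum_O|]. rewrite !sum_Sn, <- IH. reflexivity. }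
destruct l as [l1 l2].
split.
- apply is_lim_seq_ext with (1 := Hfst).
  apply (filterlim_comp _ _ _ (sum_n a) fst _ _ _ H).
  apply continuous_fst.
- apply is_lim_seq_ext with (1 := Hsnd).
  apply (filterlim_comp _ _ _ (sum_n a) snd _ _ _ H).
  apply continuous_snd.
Qed.

(** For [P] in the closed left half-plane, [P] is at least as close to [- t] as
    to [t]. *)
Lemma Cayley_Cmod_le_1 (P xi : C) (t : R) :
  fst P <= 0 -> 0 < t -> (xi * (P - RtoC t) = - (P + RtoC t))%C -> Cmod xi <= 1.
Proof.
intros HP Ht H.
assert (Hm : Cmod xi * Cmod (P - RtoC t) = Cmod (P + RtoC t))
  by (rewrite <- Cmod_mult, H; apply Cmod_opp).
assert (Hle : Cmod (P + RtoC t) <= Cmod (P - RtoC t)).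
{ unfold Cmod. apply sqrt_le_1_alt. destruct P as [p q]; simpl in *. nra. }
assert (Hpos : 0 < Cmod (P - RtoC t)).
{ apply Cmod_gt_0. intros H0. apply (f_equal fst) in H0. simpl in H0. lra. }
nra.
Qed.

Lemma nu_pos (alpha dalpha h : R) :
  0 < alpha < 1 -> 0 < dalpha -> 0 < nu alpha dalpha h.
Proof.
intros Ha Hd. unfold nu.
apply Rdiv_lt_0_compat; [exact Hd|].
apply Rmult_lt_0_compat; [|apply exp_pos].
assert (HPI := PI_RGT_0).
apply Rmult_lt_0_compat; [lra|apply cos_gt_0; nra].
Qed.

(** Already the first time step of the mode determines [xi], by
    [xi (P - 2 / tau) = - (P + 2 / tau)] with [P] the symbol of the spatial
    operator at [theta], whose real part is nonpositive. *)
Lemma mode_unconditionally_stable (alpha d1 d2 dalpha : R) (v : nat -> R) :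
  0 < alpha < 1 -> 0 < d2 -> 0 < dalpha -> generating_coeffs alpha v ->
  unconditionally_stable alpha d1 d2 dalpha v.
Proof.
intros Ha Hd2 Hda Hv tau h theta xi Htau Hh _ (SL & SR & Hser & Heq).
assert (Hnu := nu_pos alpha dalpha h Ha Hda).
set (nu0 := nu alpha dalpha h) in *.
set (S := (SL 0%Z 0%nat + SR 0%Z 0%nat)%C).
(* The two one-sided sums are complex conjugates, so [S] is twice the limit of
   the cosine sums. *)
assert (HS : fst S >= 0 /\ snd S = 0).
{ destruct (Hser 0%Z 0%nat) as [H1 H2].
  destruct (is_series_C_components _ _ (is_series_plus _ _ _ _ H1 H2)) as [Hre Him].
  change (plus (SL 0%Z 0%nat) (SR 0%Z 0%nat)) with S in Hre, Him.
  split.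
  - apply Rle_ge.
    refine (is_lim_seq_le_loc (fun _ => 0) _ (Finite 0) (Finite (fst S)) _ _ Hre);
      [|apply is_lim_seq_const].
    exists 4%nat; intros n Hn.
    rewrite (sum_n_ext _ (fun l => mult 2 (v l * cos (INR l * theta)))).
    + rewrite sum_n_mult_l. apply (Rmult_le_pos 2); [lra|].
      exact (generating_coeffs_cos_sum alpha v theta Ha Hv n Hn).
    + intros l. unfold fourier_mode, mult, plus; simpl.
      rewrite opp_IZR, <- INR_IZR_INZ, Ropp_mult_distr_l_reverse, cos_neg. ring.
  - apply (is_lim_seq_unique) in Him.
    rewrite (Lim_seq_ext _ (fun _ => 0)), Lim_seq_const in Him; [congruence|].
    intros n.
    rewrite (sum_n_ext _ (fun _ => 0)); [rewrite sum_n_const; ring|].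
    intros l. unfold fourier_mode, mult, plus; simpl.
    rewrite opp_IZR, <- INR_IZR_INZ, Ropp_mult_distr_l_reverse, sin_neg, cos_neg. ring. }
assert (Huniq : forall (a : nat -> C) (l l' : C), is_series a l -> is_series a l' -> l = l').
{ intros a l l'. exact (filterlim_locally_unique _ l l'). }
assert (HSL : SL 0%Z 1%nat = (xi * SL 0%Z 0%nat)%C).
{ apply Huniq with (1 := proj1 (Hser 0%Z 1%nat)).
  apply is_series_ext with (2 := is_series_scal xi _ _ (proj1 (Hser 0%Z 0%nat))).
  intros l. unfold fourier_mode. simpl (Cpow _ _).
  match goal with |- scal ?x ?y = ?z => change (Cmult x y = z) end. ring. }
assert (HSR : SR 0%Z 1%nat = (xi * SR 0%Z 0%nat)%C).
{ apply Huniq with (1 := proj2 (Hser 0%Z 1%nat)).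
  apply is_series_ext with (2 := is_series_scal xi _ _ (proj2 (Hser 0%Z 0%nat))).
  intros l. unfold fourier_mode. simpl (Cpow _ _).
  match goal with |- scal ?x ?y = ?z => change (Cmult x y = z) end. ring. }
specialize (Heq 0%Z 0%nat). fold nu0 in Heq.
change (0 + 1)%nat with 1%nat in Heq.
rewrite HSL, HSR in Heq.
set (A := d2 / h ^ 2 + d1 / (2 * h)) in *.
set (B := d2 / h ^ 2 - d1 / (2 * h)) in *.
set (D := 2 * d2 / h ^ 2) in *.
set (E := fun j : Z => (cos (IZR j * theta), sin (IZR j * theta)) : C).
assert (HE0 : E 0%Z = RtoC 1).
{ unfold E. rewrite Rmult_0_l, cos_0, sin_0. reflexivity. }
set (P := (RtoC A * E (0 - 1)%Z + RtoC B * E (0 + 1)%Z - RtoC D - RtoC nu0 * S)%C).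
apply (Cayley_Cmod_le_1 P xi (2 / tau)).
- assert (HAB : A + B = D) by (unfold A, B, D; field; apply Rgt_not_eq, Hh).
  assert (HD : 0 < D).
  { unfold D. apply Rdiv_lt_0_compat; [lra|apply pow_lt, Hh]. }
  assert (HP : fst P = D * (cos theta - 1) - nu0 * fst S).
  { unfold P, E; simpl. replace (-1 * theta) with (- theta) by ring.
    rewrite Rmult_1_l, cos_neg, <- HAB. ring. }
  assert (Hc := COS_bound theta). rewrite HP. nra.
- apply Rdiv_lt_0_compat; lra.
- unfold fourier_mode in Heq.
  change (fun j : Z => (cos (IZR j * theta), sin (IZR j * theta)) : C) with E in Heq.
  fold (E (0 - 1)%Z) (E (0 + 1)%Z) (E 0%Z) in Heq. rewrite HE0 in Heq.
  simpl (Cpow _ _) in Heq.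
  rewrite RtoC_plus, RtoC_minus in Heq.
  unfold P, S.
  match type of Heq with ?L = _ => transitivity L end; [ring|].
  rewrite Heq. ring.
Qed.

(** * Finite sums of real numbers *)

(** The general lemmas on [sum_n] state equalities in the carrier of an abstract
    structure, where [ring] does not apply; the following versions live in [R]. *)
Lemma sum_n_R_scal (c : R) (f : nat -> R) (n : nat) :
  sum_n (fun j => c * f j) n = c * sum_n f n :> R.
Proof. exact (sum_n_mult_l c f n). Qed.

Lemma sum_n_R_plus (f g : nat -> R) (n : nat) :
  sum_n (fun j => f j + g j) n = sum_n f n + sum_n g n :> R.
Proof. exact (sum_n_plus f g n). Qed.

Lemma sum_n_R_S (f : nat -> R) (n : nat) :
  sum_n f (S n) = sum_n f n + f (S n) :> R.
Proof. exact (sum_Sn f n). Qed.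

Lemma sum_n_R_ext (f g : nat -> R) (n : nat) :
  (forall j, (j <= n)%nat -> f j = g j) -> sum_n f n = sum_n g n :> R.
Proof. exact (sum_n_ext_loc f g n). Qed.

Lemma sum_n_R_head (f : nat -> R) (n : nat) :
  sum_n f (S n) = f 0%nat + sum_n (fun j => f (S j)) n :> R.
Proof.
induction n as [|n IH].
- rewrite sum_n_R_S, !sum_O. reflexivity.
- rewrite sum_n_R_S, IH, (sum_n_R_S (fun j => f (S j))). ring.
Qed.

Lemma sum_n_R_le (f g : nat -> R) (n : nat) :
  (forall j, (j <= n)%nat -> f j <= g j) -> sum_n f n <= sum_n g n.
Proof.
intros H. induction n as [|n IH].
- rewrite !sum_O. apply H; lia.
- rewrite !sum_n_R_S. apply Rplus_le_compat; [apply IH; intros; apply H; lia|apply H; lia].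
Qed.

Lemma sum_n_R_zero_tail (f : nat -> R) (n m : nat) :
  (n <= m)%nat -> (forall j, (n < j)%nat -> f j = 0) -> sum_n f m = sum_n f n :> R.
Proof.
intros Hnm Hf. induction Hnm as [|m Hnm IH]; [reflexivity|].
rewrite sum_n_R_S, IH, Hf by lia. ring.
Qed.

Lemma sum_n_R_rev (f : nat -> R) (n : nat) :
  sum_n (fun j => f (n - j)%nat) n = sum_n f n :> R.
Proof.
induction n as [|n IH]; [now rewrite !sum_O|].
rewrite sum_n_R_head, sum_n_R_S, Nat.sub_0_r, <- IH.
rewrite Rplus_comm. reflexivity.
Qed.

(** Exchange of the order of summation over [{(l, i) | l + i <= n}]. *)
Lemma sum_n_R_triangle (F : nat -> nat -> R) (n : nat) :
  sum_n (fun j => sum_n (fun l => F l (j - l)%nat) j) n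
  = sum_n (fun i => sum_n (fun l => F l i) (n - i)) n :> R.
Proof.
induction n as [|n IH]; [now rewrite !sum_O|].
rewrite (sum_n_R_S (fun j => sum_n (fun l => F l (j - l)%nat) j)), IH.
rewrite (sum_n_R_S (fun i => sum_n (fun l => F l i) (S n - i))), Nat.sub_diag, sum_O.
rewrite (sum_n_R_ext (fun i => sum_n (fun l => F l i) (S n - i))
  (fun i => sum_n (fun l => F l i) (n - i) + F (S n - i)%nat i)).
2:{ intros i Hi. rewrite Nat.sub_succ_l, sum_n_R_S by exact Hi. reflexivity. }
rewrite sum_n_R_plus, Rplus_assoc. f_equal.
rewrite <- (sum_n_R_rev (fun l => F l (S n - l)%nat)).
rewrite (sum_n_R_S (fun j => F (S n - j)%nat _)), Nat.sub_diag. f_equal.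
apply sum_n_R_ext. intros i Hi. f_equal. lia.
Qed.

(** * Dissipativity of the spatial discretization *)

Definition autocorrelation (p : nat -> R) (n l : nat) : R :=
  sum_n (fun j => p j * p (j + l)%nat) n.

Lemma autocorrelation_le_0 (p : nat -> R) (n l : nat) :
  (forall j, (n < j)%nat -> p j = 0) ->
  autocorrelation p n l <= autocorrelation p n 0.
Proof.
intros Hp. unfold autocorrelation.
assert (Hshift : forall l, sum_n (fun j => p (j + l)%nat ^ 2) n <= sum_n (fun j => p j ^ 2) n).
{ clear l. induction l as [|l IH].
  - right. apply sum_n_R_ext. intros j _. now rewrite Nat.add_0_r.
  - apply Rle_trans with (2 := IH).
    assert (H := sum_n_R_head (fun j => p (j + l)%nat ^ 2) n).
    rewrite sum_n_R_S, (Hp (S n + l)%nat) in H by lia.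
    rewrite (sum_n_R_ext _ (fun j => p (S j + l)%nat ^ 2)).
    + assert (H2 := pow2_ge_0 (p (0 + l)%nat)). lra.
    + intros j _. now rewrite Nat.add_succ_r. }
specialize (Hshift l).
apply Rle_trans with (sum_n (fun j => / 2 * p j ^ 2 + / 2 * p (j + l)%nat ^ 2) n).
- apply sum_n_R_le. intros j _. assert (H := pow2_ge_0 (p j - p (j + l)%nat)). lra.
- rewrite sum_n_R_plus, !sum_n_R_scal.
  rewrite (sum_n_R_ext (fun j => p j * p (j + 0)%nat) (fun j => p j ^ 2)); [lra|].
  intros j _. rewrite Nat.add_0_r. simpl. ring.
Qed.

(** [1 - cos (2 theta) <= 4 (1 - cos theta)] amounts to [|1 - w|^4 >= 0] on the unit
    circle, so the corresponding inequality for autocorrelations is the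
    nonnegativity of a sum of squared second differences. *)
Lemma autocorrelation_gap_2 (p : nat -> R) (n : nat) :
  (forall j, (n < j)%nat -> p j = 0) ->
  autocorrelation p n 0 - autocorrelation p n 2
  <= 4 * (autocorrelation p n 0 - autocorrelation p n 1).
Proof.
intros Hp. unfold autocorrelation.
(* The negative terms make up for the windows that overlap the right end. *)
assert (H : forall m,
  - (5 * p (m + 1)%nat ^ 2 - 4 * p (m + 1)%nat * p (m + 2)%nat + p (m + 2)%nat ^ 2)
  <= sum_n (fun j => 6 * (p j * p (j + 0)%nat) + - 8 * (p j * p (j + 1)%nat)
                     + 2 * (p j * p (j + 2)%nat)) m).
{ induction m as [|m IH].
  - rewrite sum_O. simpl.
    assert (H0 := pow2_ge_0 (p 0%nat - 2 * p 1%nat + p 2%nat)).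
    assert (H1 := pow2_ge_0 (p 1%nat - 2 * p 0%nat)).
    assert (H2 := pow2_ge_0 (p 0%nat)). lra.
  - rewrite sum_n_R_S. rewrite !Nat.add_0_r.
    replace (S m + 1)%nat with (m + 2)%nat by lia.
    replace (S m + 2)%nat with (m + 3)%nat by lia.
    replace (S m) with (m + 1)%nat by lia.
    assert (H0 := pow2_ge_0 (p (m + 1)%nat - 2 * p (m + 2)%nat + p (m + 3)%nat)).
    lra. }
specialize (H n). rewrite !Hp in H by lia.
rewrite !sum_n_R_plus, !sum_n_R_scal in H. lra.
Qed.

(** On the unit circle with [c = Re w],
    [9 (1 - c) - (1 - cos (3 theta)) = 4 (1 - c)^2 + 4 (1 - c)^2 (1 + c)].  The first term is
    twice that of [autocorrelation_gap_2]; the second is half of [|(1 - w)^2 (1 + w)|^2], where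
    [(1 - w)^2 (1 + w) = 1 - w - w^2 + w^3]. *)
Lemma autocorrelation_gap_3 (p : nat -> R) (n : nat) :
  (forall j, (n < j)%nat -> p j = 0) ->
  autocorrelation p n 0 - autocorrelation p n 3
  <= 9 * (autocorrelation p n 0 - autocorrelation p n 1).
Proof.
intros Hp.
assert (H2 := autocorrelation_gap_2 p n Hp).
unfold autocorrelation in *.
(* As before, the negative terms make up for the windows at the right end. *)
assert (H : forall m,
  - (p (m + 1)%nat ^ 2 + (p (m + 2)%nat - p (m + 1)%nat) ^ 2
     + (p (m + 3)%nat - p (m + 2)%nat - p (m + 1)%nat) ^ 2)
  <= sum_n (fun j => 4 * (p j * p (j + 0)%nat) + - 2 * (p j * p (j + 1)%nat)
                     + - 4 * (p j * p (j + 2)%nat) + 2 * (p j * p (j + 3)%nat)) m).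
{ induction m as [|m IH].
  - rewrite sum_O. simpl.
    assert (G0 := pow2_ge_0 (p 0%nat - p 1%nat - p 2%nat + p 3%nat)).
    assert (G1 := pow2_ge_0 (p 2%nat - p 1%nat - p 0%nat)).
    assert (G2 := pow2_ge_0 (p 1%nat - p 0%nat)).
    assert (G3 := pow2_ge_0 (p 0%nat)). lra.
  - rewrite sum_n_R_S. rewrite !Nat.add_0_r.
    replace (S m + 1)%nat with (m + 2)%nat by lia.
    replace (S m + 2)%nat with (m + 3)%nat by lia.
    replace (S m + 3)%nat with (m + 4)%nat by lia.
    replace (S m) with (m + 1)%nat by lia.
    assert (G := pow2_ge_0 (p (m + 1)%nat - p (m + 2)%nat - p (m + 3)%nat + p (m + 4)%nat)).
    lra. }
specialize (H n). rewrite !Hp in H by lia.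
rewrite !sum_n_R_plus, !sum_n_R_scal in H. lra.
Qed.

Definition riesz_sums (v : nat -> R) (M : nat) (p : nat -> R) (j : nat) : R :=
  sum_n (fun l => v l * p (j - l)%nat) j + sum_n (fun l => v l * p (j + l)%nat) (M - j).

(** The left-sided and the right-sided sum give the same quadratic form, being
    transposes of each other; both regroup by the distance [l] of the two
    nodes. *)
Lemma riesz_sums_form (v p : nat -> R) (M n m : nat) :
  (n <= M <= m)%nat -> (forall j, (n < j)%nat -> p j = 0) ->
  sum_n (fun j => p j * riesz_sums v M p j) n
  = 2 * sum_n (fun l => v l * autocorrelation p n l) m :> R.
Proof.
intros HM Hp. unfold riesz_sums.
assert (Hform : sum_n (fun i => sum_n (fun l => v l * (p i * p (i + l)%nat)) m) n
  = sum_n (fun l => v l * autocorrelation p n l) m :> R).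
{ rewrite (sum_n_switch (fun i l => v l * (p i * p (i + l)%nat))).
  apply sum_n_R_ext. intros l _. apply sum_n_R_scal. }
rewrite (sum_n_R_ext _ (fun j => sum_n (fun l => v l * (p (j - l)%nat * p (j - l + l)%nat)) j
  + sum_n (fun l => v l * (p j * p (j + l)%nat)) (M - j))).
2:{ intros j _. rewrite Rmult_plus_distr_l, <- !sum_n_R_scal. f_equal.
  - apply sum_n_R_ext. intros l Hl. rewrite Nat.sub_add by exact Hl. ring.
  - apply sum_n_R_ext. intros l _. ring. }
rewrite sum_n_R_plus, (sum_n_R_triangle (fun l i => v l * (p i * p (i + l)%nat))).
rewrite <- Hform.
match goal with |- ?a + ?b = 2 * ?c => assert (a = c /\ b = c) as [-> ->]; [|ring] end.
split; apply sum_n_R_ext; intros j Hj; symmetry;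
  apply sum_n_R_zero_tail; try lia; intros l Hl; rewrite (Hp (j + l)%nat) by lia; ring.
Qed.

Lemma riesz_sums_nonneg (alpha : R) (v p : nat -> R) (M n : nat) :
  0 < alpha < 1 -> generating_coeffs alpha v ->
  (n <= M)%nat -> (forall j, (n < j)%nat -> p j = 0) ->
  0 <= sum_n (fun j => p j * riesz_sums v M p j) n.
Proof.
intros Ha Hv HM Hp.
(* Four zero terms are appended so that the sum reaches index 4 on coarse grids. *)
rewrite (riesz_sums_form v p M n (M + 4)) by (lia || assumption).
apply Rmult_le_pos; [lra|].
apply generating_coeffs_weighted_sum with alpha; auto.
- apply Rle_trans with (sum_n (fun _ => 0) n); [rewrite sum_n_const; lra|].
  apply sum_n_R_le. intros j _. rewrite Nat.add_0_r. nra.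
- intros l. now apply autocorrelation_le_0.
- now apply autocorrelation_gap_2.
- now apply autocorrelation_gap_3.
- lia.
Qed.

Definition space_discretization (d1 d2 nu h : R) (v : nat -> R) (M : nat)
    (p : nat -> R) (j : nat) : R :=
  - d1 * ((p (j + 1)%nat - p (j - 1)%nat) / (2 * h))
  + d2 * ((p (j + 1)%nat - 2 * p j + p (j - 1)%nat) / h ^ 2)
  - nu * riesz_sums v M p j.

Lemma space_discretization_ext (d1 d2 nu h : R) (v : nat -> R) (M : nat)
    (p q : nat -> R) (j : nat) :
  (1 <= j <= M - 1)%nat -> (forall i, (i <= M)%nat -> p i = q i) ->
  space_discretization d1 d2 nu h v M p j = space_discretization d1 d2 nu h v M q j.
Proof.
intros Hj H. unfold space_discretization, riesz_sums.
rewrite !H by lia. do 3 f_equal;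
  apply sum_n_R_ext; intros l Hl; rewrite H by lia; reflexivity.
Qed.

Lemma space_discretization_linear (d1 d2 nu h : R) (v : nat -> R) (M : nat)
    (c : R) (p q : nat -> R) (j : nat) :
  space_discretization d1 d2 nu h v M (fun i => p i + c * q i) j
  = space_discretization d1 d2 nu h v M p j
    + c * space_discretization d1 d2 nu h v M q j.
Proof.
unfold space_discretization, riesz_sums.
assert (H : forall (s : nat -> nat) n, sum_n (fun l => v l * (p (s l) + c * q (s l))) n
  = sum_n (fun l => v l * p (s l)) n + c * sum_n (fun l => v l * q (s l)) n :> R).
{ intros s n. rewrite <- sum_n_R_scal, <- sum_n_R_plus.
  apply sum_n_R_ext. intros l _. ring. }
rewrite (H (fun l => (j - l)%nat)), (H (fun l => (j + l)%nat)).
unfold Rdiv. ring.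
Qed.

(** The boundary values of [p] vanish and its values beyond [M] do not enter, so
    [p] may be cut off outside the grid; then the first difference contributes 0,
    and the second difference and the Riesz sums contribute with the right
    sign. *)
Lemma space_discretization_dissipative (alpha d1 d2 nu h : R) (v : nat -> R) (M : nat)
    (p : nat -> R) :
  0 < alpha < 1 -> generating_coeffs alpha v -> 0 <= d2 -> 0 <= nu -> 0 < h ->
  (1 <= M)%nat -> p 0%nat = 0 -> p M = 0 ->
  sum_n (fun j => p j * space_discretization d1 d2 nu h v M p j) (M - 1) <= 0.
Proof.
intros Ha Hv Hd2 Hnu Hh HM Hp0 HpM.
set (q := fun j => if (j <? M)%nat then p j else 0).
assert (Hq : forall i, (i <= M)%nat -> p i = q i).
{ intros i Hi. unfold q. destruct (Nat.ltb_spec i M) as [|Hge]; [reflexivity|].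
  now replace i with M by lia. }
assert (Hq' : forall j, (M - 1 < j)%nat -> q j = 0).
{ intros j Hj. unfold q. destruct (Nat.ltb_spec j M); [lia|reflexivity]. }
assert (Hq0 : q 0%nat = 0) by (rewrite <- Hq by lia; exact Hp0).
rewrite (sum_n_R_ext _ (fun j =>
  - d1 / (2 * h) * (q j * (q (j + 1)%nat - q (j - 1)%nat))
  + d2 / h ^ 2 * (q j * (q (j + 1)%nat - 2 * q j + q (j - 1)%nat))
  + - nu * (q j * riesz_sums v M q j))).
2:{ intros j Hj. rewrite Hq by lia.
  destruct j as [|j]; [rewrite Hq0; ring|].
  rewrite (space_discretization_ext _ _ _ _ _ _ p q) by (lia || assumption).
  unfold space_discretization. field. now apply Rgt_not_eq. }
rewrite !sum_n_R_plus, !sum_n_R_scal.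
assert (H1 : forall n, sum_n (fun j => q j * (q (j + 1)%nat - q (j - 1)%nat)) n
  = q n * q (n + 1)%nat :> R).
{ induction n as [|n IH]; [rewrite sum_O; simpl; rewrite Hq0; ring|].
  rewrite sum_n_R_S, IH. replace (S n - 1)%nat with n by lia.
  rewrite Nat.add_1_r. ring. }
assert (H2 : forall n, sum_n (fun j => q j * (q (j + 1)%nat - 2 * q j + q (j - 1)%nat)) n
  <= q n * q (n + 1)%nat).
{ assert (H2' : forall n, sum_n (fun j => q j * (q (j + 1)%nat - 2 * q j + q (j - 1)%nat)) n
  <= q n * q (n + 1)%nat - q n ^ 2).
  { induction n as [|n IH]; [rewrite sum_O; simpl; rewrite Hq0; lra|].
  rewrite sum_n_R_S. replace (S n - 1)%nat with n by lia.
  rewrite Nat.add_1_r in IH. assert (H := pow2_ge_0 (q n - q (S n))). lra. }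
  intros n. specialize (H2' n). assert (H := pow2_ge_0 (q n)). lra. }
specialize (H2 (M - 1)%nat).
rewrite H1. rewrite (Hq' (M - 1 + 1)%nat) in * by lia. rewrite Rmult_0_r in *.
assert (H3 := riesz_sums_nonneg alpha v q M (M - 1) Ha Hv ltac:(lia) Hq').
assert (Hc : 0 <= d2 / h ^ 2).
{ apply Rdiv_le_0_compat; [exact Hd2|now apply pow_lt]. }
nra.
Qed.

(** * Energy estimate for one time step *)

Definition grid_norm (h : R) (n : nat) (w : nat -> R) : R :=
  sqrt (h * sum_n (fun j => w j ^ 2) n).

Lemma sum_n_R_sqr_nonneg (w : nat -> R) (n : nat) : 0 <= sum_n (fun j => w j ^ 2) n.
Proof.
apply Rle_trans with (sum_n (fun _ => 0) n); [rewrite sum_n_const; lra|].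
apply sum_n_R_le. intros j _. apply pow2_ge_0.
Qed.

Lemma grid_norm_sqr (h : R) (n : nat) (w : nat -> R) :
  0 <= h -> grid_norm h n w ^ 2 = h * sum_n (fun j => w j ^ 2) n.
Proof.
intros Hh. unfold grid_norm. apply pow2_sqrt.
apply Rmult_le_pos; [exact Hh|apply sum_n_R_sqr_nonneg].
Qed.

(** Cauchy-Schwarz against the constant 1. *)
Lemma sqr_sum_abs_le (w : nat -> R) (n : nat) :
  sum_n (fun j => Rabs (w j)) n ^ 2 <= INR (S n) * sum_n (fun j => w j ^ 2) n.
Proof.
induction n as [|n IH].
- rewrite !sum_O. rewrite pow2_abs. simpl. lra.
- rewrite !sum_n_R_S, (S_INR (S n)).
  assert (Hn := lt_0_INR (S n) ltac:(lia)).
  set (m := INR (S n)) in *.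
  set (s := sum_n _ n) in *. set (Q := sum_n (fun j => w j ^ 2) n) in *.
  rewrite <- (pow2_abs (w (S n))). set (x := Rabs _).
  apply Rmult_le_reg_l with m; [exact Hn|].
  assert (H := pow2_ge_0 (s - m * x)).
  assert (H2 : (m + 1) * s ^ 2 <= (m + 1) * (m * Q)) by (apply Rmult_le_compat_l; lra).
  lra.
Qed.

Lemma sum_abs_le_grid_norm (h : R) (n : nat) (w : nat -> R) :
  0 <= h ->
  h * sum_n (fun j => Rabs (w j)) n <= sqrt (h * INR (S n)) * grid_norm h n w.
Proof.
intros Hh. unfold grid_norm.
assert (HQ := sum_n_R_sqr_nonneg w n).
assert (HI := pos_INR (S n)).
rewrite <- sqrt_mult by (apply Rmult_le_pos; assumption).
apply Rsqr_incr_0_var; [|apply sqrt_pos].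
rewrite Rsqr_sqrt by (repeat apply Rmult_le_pos; assumption).
rewrite Rsqr_pow2, Rpow_mult_distr.
assert (H := Rmult_le_compat_l (h ^ 2) _ _ (pow2_ge_0 h) (sqr_sum_abs_le w n)).
lra.
Qed.

(** Testing the scheme with [w1 + w0] gives
    [|w1|^2 - |w0|^2 <= tau B sqrt (h (n + 1)) (|w1| + |w0|)], and the factor [|w1| + |w0|]
    cancels. *)
Lemma crank_nicolson_step_le (h tau B : R) (A : (nat -> R) -> nat -> R) (n : nat)
    (w0 w1 rho : nat -> R) :
  0 < h -> 0 < tau -> 0 <= B ->
  w0 0%nat = 0 -> w1 0%nat = 0 ->
  sum_n (fun j => (w1 j + w0 j) * A (fun i => w1 i + 1 * w0 i) j) n <= 0 ->
  (forall j, (1 <= j <= n)%nat ->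
     (w1 j - w0 j) / tau = / 2 * A (fun i => w1 i + 1 * w0 i) j + rho j /\
     Rabs (rho j) <= B) ->
  grid_norm h n w1 <= grid_norm h n w0 + tau * (sqrt (h * INR (S n)) * B).
Proof.
intros Hh Htau HB H00 H10 HA Heq.
set (X0 := grid_norm h n w0). set (X1 := grid_norm h n w1).
assert (HX0 : 0 <= X0) by apply sqrt_pos.
assert (HX1 : 0 <= X1) by apply sqrt_pos.
set (c := sqrt (h * INR (S n))).
assert (Hc : 0 <= c) by apply sqrt_pos.
assert (Hpoint : sum_n (fun j => w1 j ^ 2) n <= sum_n (fun j => w0 j ^ 2
  + tau / 2 * ((w1 j + w0 j) * A (fun i => w1 i + 1 * w0 i) j)
  + tau * B * (Rabs (w1 j) + Rabs (w0 j))) n).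
{ apply sum_n_R_le. intros j Hj.
  destruct j as [|j].
  - rewrite H00, H10, Rabs_R0. lra.
  - destruct (Heq (S j) ltac:(lia)) as [E Hrho].
    set (a := A _ _) in *. clearbody a.
    set (x := w1 (S j)) in *. set (y := w0 (S j)) in *.
    assert (Exy : x - y = tau * (/ 2 * a + rho (S j))).
    { rewrite <- E. field. apply Rgt_not_eq, Htau. }
    assert (Hr : rho (S j) * (x + y) <= B * (Rabs x + Rabs y)).
    { apply Rle_trans with (1 := Rle_abs _). rewrite Rabs_mult.
      apply Rmult_le_compat; try apply Rabs_pos; [exact Hrho|apply Rabs_triang]. }
    apply (Rmult_le_compat_l tau _ _ (Rlt_le _ _ Htau)) in Hr.
    assert (Esq : x ^ 2 = y ^ 2 + (x - y) * (x + y)) by ring.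
    rewrite Esq, Exy. lra. }
rewrite !sum_n_R_plus, !sum_n_R_scal, sum_n_R_plus in Hpoint.
assert (H1 := sum_abs_le_grid_norm h n w1 (Rlt_le _ _ Hh)).
assert (H0 := sum_abs_le_grid_norm h n w0 (Rlt_le _ _ Hh)).
assert (E1 := grid_norm_sqr h n w1 (Rlt_le _ _ Hh)).
assert (E0 := grid_norm_sqr h n w0 (Rlt_le _ _ Hh)).
fold X0 in H0, E0. fold X1 in H1, E1. fold c in H0, H1.
assert (HtB : 0 <= tau * B) by (apply Rmult_le_pos; lra).
assert (Hen : X1 ^ 2 <= X0 ^ 2 + tau * B * c * (X1 + X0)).
{ rewrite E1, E0.
  apply (Rmult_le_compat_l h _ _ (Rlt_le _ _ Hh)) in Hpoint.
  apply (Rmult_le_compat_l (tau * B) _ _ HtB) in H0, H1.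
  assert (HhA : h * (tau / 2) * sum_n (fun j => (w1 j + w0 j) * A (fun i => w1 i + 1 * w0 i) j) n <= 0).
  { assert (0 <= h * (tau / 2)) by (apply Rmult_le_pos; lra). nra. }
  lra. }
assert (HtBc : 0 <= tau * (c * B)).
{ apply Rmult_le_pos; [lra|apply Rmult_le_pos; assumption]. }
destruct (Rle_lt_dec (X1 + X0) 0) as [Hz|Hpos]; [lra|].
apply Rmult_le_reg_l with (X1 + X0); [exact Hpos|]. nra.
Qed.

(** * Truncation error *)

Lemma Derive_of_is_derive_within (T t l : R) (f : R -> R) :
  0 < t < T -> is_derive_within (fun r => 0 <= r <= T) f t l -> Derive f t = l.
Proof.
intros Ht H. apply is_derive_unique, is_derive_Reals.
intros eps Heps.
destruct (H (ball l (mkposreal eps Heps)) (locally_ball _ _)) as [d Hd].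
assert (Hm : 0 < Rmin d (Rmin t (T - t))).
{ repeat apply Rmin_pos; [apply cond_pos|lra|lra]. }
exists (mkposreal _ Hm). intros k Hk Hkd. simpl in Hkd.
assert (Hkd1 := Rlt_le_trans _ _ _ Hkd (Rmin_l _ _)).
assert (Hkd2 := Rlt_le_trans _ _ _ Hkd (Rle_trans _ _ _ (Rmin_r _ _) (Rmin_l _ _))).
assert (Hkd3 := Rlt_le_trans _ _ _ Hkd (Rle_trans _ _ _ (Rmin_r _ _) (Rmin_r _ _))).
apply Rabs_def2 in Hkd2, Hkd3.
replace k with (t + k - t) at 2 by ring.
apply (Hd (t + k)).
- change (Rabs (t + k - t) < d). replace (t + k - t) with k by ring. exact Hkd1.
- lra.
- lra.
Qed.

Lemma Series_finite (f : nat -> R) (n : nat) :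
  (forall l, (n < l)%nat -> f l = 0) -> Series f = sum_n f n.
Proof.
intros Hf. apply is_series_unique.
change (is_lim_seq (sum_n f) (sum_n f n)).
apply is_lim_seq_ext_loc with (fun _ => sum_n f n); [|apply is_lim_seq_const].
exists n. intros m Hm. symmetry. apply sum_n_R_zero_tail; assumption.
Qed.

(** For the extension by zero, the infinite sums of the consistency hypothesis are
    those of the scheme. *)
Lemma Series_zero_ext (a b h : R) (v : nat -> R) (f : R -> R) (M j : nat) :
  0 < h -> INR M * h = b - a -> (j <= M)%nat ->
  Series (fun l => v l * (zero_ext a b f (a + INR j * h - INR l * h)
                          + zero_ext a b f (a + INR j * h + INR l * h)))
  = riesz_sums v M (fun i => f (a + INR i * h)) j.
Proof.
intros Hh HM Hj.
assert (Hin : forall i, (i <= M)%nat -> zero_ext a b f (a + INR i * h) = f (a + INR i * h)).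
{ intros i Hi. apply le_INR in Hi. assert (Hi0 := pos_INR i).
  unfold zero_ext.
  destruct (Rle_dec a (a + INR i * h)) as [|n]; [|exfalso; apply n; nra].
  destruct (Rle_dec (a + INR i * h) b) as [|n']; [reflexivity|exfalso; apply n'; nra]. }
assert (Hleft : forall l, (l <= j)%nat ->
  zero_ext a b f (a + INR j * h - INR l * h) = f (a + INR (j - l) * h)).
{ intros l Hl. rewrite <- Hin by lia. rewrite minus_INR by exact Hl. f_equal. ring. }
assert (Hleft0 : forall l, (j < l)%nat -> zero_ext a b f (a + INR j * h - INR l * h) = 0).
{ intros l Hl. apply lt_INR in Hl. unfold zero_ext.
  destruct (Rle_dec a _) as [H|]; [exfalso; nra|reflexivity]. }
assert (Hright : forall l, (l <= M - j)%nat ->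
  zero_ext a b f (a + INR j * h + INR l * h) = f (a + INR (j + l) * h)).
{ intros l Hl. rewrite <- Hin by lia. rewrite plus_INR. f_equal. ring. }
assert (Hright0 : forall l, (M - j < l)%nat ->
  zero_ext a b f (a + INR j * h + INR l * h) = 0).
{ intros l Hl. assert (Hl' : (M < j + l)%nat) by lia.
  apply lt_INR in Hl'. rewrite plus_INR in Hl'. unfold zero_ext.
  destruct (Rle_dec a _) as [_|]; [|reflexivity].
  destruct (Rle_dec _ b) as [H|]; [exfalso; nra|reflexivity]. }
rewrite (Series_finite _ M).
2:{ intros l Hl. rewrite Hleft0, Hright0 by lia. ring. }
unfold riesz_sums.
rewrite (sum_n_R_ext _ (fun l => v l * zero_ext a b f (a + INR j * h - INR l * h)
   + v l * zero_ext a b f (a + INR j * h + INR l * h))) by (intros; ring).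
rewrite sum_n_R_plus. f_equal.
- rewrite (sum_n_R_zero_tail _ j M) by (lia || (intros l Hl; rewrite Hleft0 by lia; ring)).
  apply sum_n_R_ext. intros l Hl. now rewrite Hleft.
- rewrite (sum_n_R_zero_tail _ (M - j) M)
    by (lia || (intros l Hl; rewrite Hright0 by lia; ring)).
  apply sum_n_R_ext. intros l Hl. now rewrite Hright.
Qed.

Lemma space_discretization_consistent (alpha d1 d2 dalpha a b h K : R) (v : nat -> R)
    (M j : nat) (f : R -> R) :
  0 <= d1 -> 0 <= d2 -> 0 <= dalpha ->
  0 < h -> INR M * h = b - a -> (1 <= j <= M - 1)%nat ->
  let x (i : nat) := a + INR i * h in
  Rabs ((f (x (j + 1)%nat) - f (x (j - 1)%nat)) / (2 * h) - Derive f (x j)) <= K ->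
  Rabs ((f (x (j + 1)%nat) - 2 * f (x j) + f (x (j - 1)%nat)) / h ^ 2
        - Derive_n f 2 (x j)) <= K ->
  Rabs (riesz alpha a b f (x j)
        - - (1 / (2 * cos (PI * alpha / 2) * Rpower h alpha)) *
          Series (fun l => v l * (zero_ext a b f (x j - INR l * h)
                                  + zero_ext a b f (x j + INR l * h)))) <= K ->
  Rabs (space_discretization d1 d2 (nu alpha dalpha h) h v M (fun i => f (x i)) j
        - space_operator alpha d1 d2 dalpha a b f (x j)) <= (d1 + d2 + dalpha) * K.
Proof.
intros Hd1 Hd2 Hda Hh HM Hj x H1 H2 H3.
unfold x in H3. rewrite (Series_zero_ext a b h v f M j Hh HM ltac:(lia)) in H3.
fold (x j) in H3. change (fun i => f (a + INR i * h)) with (fun i => f (x i)) in H3.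
unfold space_discretization, space_operator.
replace (nu alpha dalpha h)
  with (dalpha * (1 / (2 * cos (PI * alpha / 2) * Rpower h alpha)))
  by (unfold nu, Rdiv; ring).
set (D1 := (_ - _) / (2 * h)) in *. set (D2 := _ / h ^ 2) in *.
set (c := 1 / _) in *. set (S := riesz_sums _ _ _ _) in *.
apply Rabs_le_between in H1, H2, H3. apply Rabs_le_between.
destruct H1 as [H1 H1'], H2 as [H2 H2'], H3 as [H3 H3'].
apply (Rmult_le_compat_l d1 _ _ Hd1) in H1, H1'.
apply (Rmult_le_compat_l d2 _ _ Hd2) in H2, H2'.
apply (Rmult_le_compat_l dalpha _ _ Hda) in H3, H3'.
split; lra.
Qed.

Lemma solves_scheme_crank_nicolson (alpha d1 d2 dalpha a b T : R) (v : nat -> R)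
    (s : R -> R -> R) (phi : R -> R) (M N : nat) (U : nat -> nat -> R) :
  solves_scheme alpha d1 d2 dalpha a b T v s phi M N U ->
  forall j k : nat, (1 <= j <= M - 1)%nat -> (k < N)%nat ->
  let h := step (b - a) M in
  let tau := step T N in
  let A (p : nat -> R) := space_discretization d1 d2 (nu alpha dalpha h) h v M p j in
  (U j (k + 1)%nat - U j k) / tau
  = / 2 * (A (fun i => U i (k + 1)%nat) + A (fun i => U i k))
    + s (a + INR j * h) (INR k * tau + tau / 2).
Proof.
intros [Heq _] j k Hj Hk h tau A. specialize (Heq j k Hj Hk). cbv zeta in Heq.
fold h tau in Heq. fold (nu alpha dalpha h) in Heq.
unfold A, space_discretization, riesz_sums.
lra.
Qed.

(** The equation at the intermediate time replaces [u_t - L u] by [s] in the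
    Crank-Nicolson error, and the spatial error enters at the two time levels with
    weight 1/2 each. *)
Lemma truncation_error (alpha d1 d2 dalpha a b T : R) (v : nat -> R)
    (s : R -> R -> R) (phi : R -> R) (u : R -> R -> R) :
  0 <= d1 -> 0 <= d2 -> 0 <= dalpha -> a < b -> 0 < T ->
  solves_ibvp alpha d1 d2 dalpha a b T s phi u ->
  consistent alpha d1 d2 dalpha a b T v u ->
  exists K : R, 0 <= K /\
  forall M N j k : nat, (1 <= j <= M - 1)%nat -> (k < N)%nat ->
  let h := step (b - a) M in
  let tau := step T N in
  let x (i : nat) := a + INR i * h in
  let t (k : nat) := INR k * tau in
  let A (p : nat -> R) := space_discretization d1 d2 (nu alpha dalpha h) h v M p j in
  Rabs ((u (x j) (t (k + 1)%nat) - u (x j) (t k)) / tau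
    - (/ 2 * (A (fun i => u (x i) (t (k + 1)%nat)) + A (fun i => u (x i) (t k)))
       + s (x j) (t k + tau / 2))) <= K * (tau ^ 2 + h ^ 2).
Proof.
intros Hd1 Hd2 Hda Hab HT (Hpde & _ & _) (_ & K & HK).
exists ((1 + d1 + d2 + dalpha) * Rabs K).
split; [apply Rmult_le_pos; [lra|apply Rabs_pos]|].
intros M N j k Hj Hk h tau x t A.
assert (HMpos : 0 < INR M) by (apply lt_0_INR; lia).
assert (HNpos : 0 < INR N) by (apply lt_0_INR; lia).
assert (Hh : 0 < h) by (apply Rdiv_lt_0_compat; lra).
assert (Htau : 0 < tau) by (apply Rdiv_lt_0_compat; lra).
assert (HMh : INR M * h = b - a) by (unfold h, step; field; lra).
assert (HNt : INR N * tau = T) by (unfold tau, step; field; lra).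
destruct (HK M N ltac:(lia) ltac:(lia)) as [Htime Hspace]. cbv zeta in Htime, Hspace.
fold h tau in Htime, Hspace. clear HK.
assert (Hsp : forall k', (k' <= N)%nat ->
  Rabs (A (fun i => u (x i) (t k'))
    - space_operator alpha d1 d2 dalpha a b (fun y => u y (t k')) (x j))
  <= (d1 + d2 + dalpha) * (K * h ^ 2)).
{ intros k' Hk'. destruct (Hspace j k' Hj Hk') as (S1 & S2 & S3).
  apply (space_discretization_consistent alpha d1 d2 dalpha a b h _ v M j
    (fun y => u y (t k'))); assumption. }
specialize (Htime j k Hj Hk).
assert (Hxj : a < x j < b).
{ unfold x. assert (HJ : 1 <= INR j) by (apply (le_INR 1); lia).
  assert (HJ' : INR j + 1 <= INR M) by (rewrite <- S_INR; apply le_INR; lia).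
  split; nra. }
assert (Htk : 0 < t k + tau / 2 < T).
{ unfold t. assert (HJ := pos_INR k).
  assert (HJ' : INR k + 1 <= INR N) by (rewrite <- S_INR; apply le_INR; lia).
  split; nra. }
destruct (Hpde (t k + tau / 2) ltac:(lra)) as [_ Hd].
specialize (Hd (x j) Hxj).
rewrite (Derive_of_is_derive_within T (INR k * tau + tau / 2) _
  (u (a + INR j * h)) Htk Hd) in Htime.
assert (G1 := Hsp (k + 1)%nat ltac:(lia)). assert (G0 := Hsp k ltac:(lia)).
change (a + INR j * h) with (x j) in Htime.
change (INR k * tau) with (t k) in Htime.
change (INR (k + 1) * tau) with (t (k + 1)%nat) in Htime.
assert (HKa : K <= Rabs K) by apply Rle_abs.
assert (Q1 : K * tau ^ 2 <= Rabs K * tau ^ 2)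
  by (apply Rmult_le_compat_r; [apply pow2_ge_0|exact HKa]).
assert (Q2 : (d1 + d2 + dalpha) * (K * h ^ 2) <= (d1 + d2 + dalpha) * (Rabs K * h ^ 2)).
{ apply Rmult_le_compat_l; [lra|].
  apply Rmult_le_compat_r; [apply pow2_ge_0|exact HKa]. }
assert (Q3 : 0 <= Rabs K * h ^ 2).
{ apply Rmult_le_pos; [apply Rabs_pos|apply pow2_ge_0]. }
assert (Q4 : 0 <= (d1 + d2 + dalpha) * (Rabs K * tau ^ 2)).
{ apply Rmult_le_pos; [lra|apply Rmult_le_pos; [apply Rabs_pos|apply pow2_ge_0]]. }
apply Rabs_le_between in G0, G1, Htime. apply Rabs_le_between.
set (A1 := A _) in *. set (A0 := A (fun i => u (x i) (t k))) in *.
split; lra.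
Qed.

(** * Convergence and the theorem *)

Lemma sum_n_m_1_sum_n (f : nat -> R) (n : nat) :
  f 0%nat = 0 -> sum_n_m f 1 n = sum_n f n :> R.
Proof.
intros H0. unfold sum_n. rewrite (sum_Sn_m f 0 n) by lia.
rewrite H0. symmetry. apply Rplus_0_l.
Qed.

Lemma scheme_second_order_convergent (alpha d1 d2 dalpha a b T : R) (v : nat -> R)
    (s : R -> R -> R) (phi : R -> R) (u : R -> R -> R) :
  0 < alpha < 1 -> generating_coeffs alpha v ->
  0 <= d1 -> 0 <= d2 -> 0 < dalpha -> a < b -> 0 < T ->
  solves_ibvp alpha d1 d2 dalpha a b T s phi u ->
  consistent alpha d1 d2 dalpha a b T v u ->
  second_order_convergent alpha d1 d2 dalpha a b T v s phi u.
Proof.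
intros Ha Hv Hd1 Hd2 Hda Hab HT Hu Hcons.
destruct (truncation_error alpha d1 d2 dalpha a b T v s phi u Hd1 Hd2
  (Rlt_le _ _ Hda) Hab HT Hu Hcons) as (K & HK0 & HK).
exists (T * (sqrt (b - a) * K)).
intros M N U HM HN HU h tau.
assert (HMpos : 0 < INR M) by (apply lt_0_INR; lia).
assert (HNpos : 0 < INR N) by (apply lt_0_INR; lia).
assert (Hh : 0 < h) by (apply Rdiv_lt_0_compat; lra).
assert (Htau : 0 < tau) by (apply Rdiv_lt_0_compat; lra).
assert (HMh : INR M * h = b - a) by (unfold h, step; field; lra).
assert (HNt : INR N * tau = T) by (unfold tau, step; field; lra).
assert (Hnu := nu_pos alpha dalpha h Ha Hda).
set (nu0 := nu alpha dalpha h) in *.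
set (w := fun k j => u (a + INR j * h) (INR k * tau) - U j k).
assert (Hbd : forall k, (k <= N)%nat -> w k 0%nat = 0 /\ w k M = 0).
{ intros k Hk. destruct Hu as (_ & _ & Hub). destruct HU as (_ & _ & HUb).
  destruct (HUb k Hk) as [HU0 HUM].
  assert (Hkt : 0 <= INR k * tau <= T).
  { apply le_INR in Hk. assert (Hk0 := pos_INR k). split; nra. }
  destruct (Hub _ Hkt) as [Hua Hub']. unfold w. rewrite HU0, HUM.
  simpl (INR 0). rewrite Rmult_0_l, Rplus_0_r, Hua.
  rewrite HMh. replace (a + (b - a)) with b by ring. rewrite Hub'. split; ring. }
assert (Hinit : forall j, (j <= M)%nat -> w 0%nat j = 0).
{ intros j Hj. destruct Hu as (_ & Hu0 & _). destruct HU as (_ & HU0 & _).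
  unfold w. rewrite HU0 by exact Hj. simpl (INR 0). rewrite Rmult_0_l.
  rewrite Hu0; [fold h; ring|].
  apply le_INR in Hj. assert (Hj0 := pos_INR j). split; nra. }
set (B := K * (tau ^ 2 + h ^ 2)).
assert (HB : 0 <= B).
{ apply Rmult_le_pos; [exact HK0|].
  assert (H1 := pow2_ge_0 tau). assert (H2 := pow2_ge_0 h). lra. }
assert (Hstep : forall k, (k < N)%nat -> grid_norm h (M - 1) (w (k + 1)%nat)
  <= grid_norm h (M - 1) (w k) + tau * (sqrt (b - a) * B)).
{ intros k Hk.
  destruct (Hbd k ltac:(lia)) as [L0 R0]. destruct (Hbd (k + 1)%nat ltac:(lia)) as [L1 R1].
  set (r := fun j => (w (k + 1)%nat j - w k j) / tau
    - / 2 * space_discretization d1 d2 nu0 h v M (fun i => w (k + 1)%nat i + 1 * w k i) j).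
  replace (b - a) with (h * INR (S (M - 1)))
    by (replace (S (M - 1)) with M by lia; rewrite <- HMh; ring).
  apply (crank_nicolson_step_le h tau B (space_discretization d1 d2 nu0 h v M)
    (M - 1) (w k) (w (k + 1)%nat) r); try assumption.
  - rewrite (sum_n_R_ext _ (fun j => (w (k + 1)%nat j + 1 * w k j)
      * space_discretization d1 d2 nu0 h v M (fun i => w (k + 1)%nat i + 1 * w k i) j))
      by (intros; ring).
    apply (space_discretization_dissipative alpha); try assumption.
    + lra.
    + rewrite L0, L1. ring.
    + rewrite R0, R1. ring.
  - intros j Hj. split; [unfold r; ring|].
    specialize (HK M N j k Hj Hk). cbv zeta in HK. fold h tau nu0 in HK. fold B in HK.
    assert (HUj := solves_scheme_crank_nicolson _ _ _ _ _ _ _ _ _ _ _ _ _ HU j k Hj Hk).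
    cbv zeta in HUj. fold h tau nu0 in HUj.
    set (A := space_discretization d1 d2 nu0 h v M) in *.
    assert (Hw : forall k', A (w k') j
      = A (fun i => u (a + INR i * h) (INR k' * tau)) j - A (fun i => U i k') j).
    { intros k'. unfold A.
      assert (E := space_discretization_linear d1 d2 nu0 h v M (-1)
        (fun i => u (a + INR i * h) (INR k' * tau)) (fun i => U i k') j).
      rewrite (space_discretization_ext _ _ _ _ _ _ _ (w k')) in E by
        (lia || (intros; unfold w; ring)).
      rewrite E. ring. }
    replace (r j) with ((u (a + INR j * h) (INR (k + 1) * tau) - u (a + INR j * h) (INR k * tau)) / tau -
      (/ 2 * (A (fun i => u (a + INR i * h) (INR (k + 1) * tau)) j
         + A (fun i => u (a + INR i * h) (INR k * tau)) j)
       + s (a + INR j * h) (INR k * tau + tau / 2))); [exact HK|].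
    unfold r. unfold A at 3. rewrite space_discretization_linear. fold A.
    rewrite !Hw. unfold w. lra. }
assert (Hind : forall k, (k <= N)%nat ->
  grid_norm h (M - 1) (w k) <= INR k * (tau * (sqrt (b - a) * B))).
{ induction k as [|k IH]; intros Hk.
  - right. simpl (INR 0). rewrite Rmult_0_l, <- sqrt_0. unfold grid_norm. f_equal.
    rewrite (sum_n_R_ext _ (fun _ => 0)).
    + rewrite sum_n_const. ring.
    + intros j Hj. rewrite Hinit by lia. ring.
  - assert (H := Hstep k ltac:(lia)). rewrite Nat.add_1_r in H.
    specialize (IH ltac:(lia)). rewrite S_INR. lra. }
intros k Hk.
apply Rle_trans with (INR k * (tau * (sqrt (b - a) * B))).
- apply Rle_trans with (2 := Hind k Hk). right. unfold grid_norm. do 2 f_equal.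
  rewrite sum_n_m_1_sum_n.
  + apply sum_n_R_ext. intros j _. apply pow2_abs.
  + rewrite pow2_abs. fold (w k 0%nat). rewrite (proj1 (Hbd k Hk)). ring.
- assert (HkN := le_INR _ _ Hk).
  assert (HsB : 0 <= sqrt (b - a) * B) by (apply Rmult_le_pos; [apply sqrt_pos|exact HB]).
  replace (T * (sqrt (b - a) * K) * (tau ^ 2 + h ^ 2)) with (T * (sqrt (b - a) * B))
    by (unfold B; ring).
  rewrite <- Rmult_assoc. apply Rmult_le_compat_r; [exact HsB|].
  rewrite <- HNt. apply Rmult_le_compat_r; lra.
Qed.

Theorem theorem3p1 :
  forall (alpha d1 d2 dalpha : R) (varpi : nat -> R),
    0 < alpha < 1 -> 0 < d1 -> 0 < d2 -> 0 < dalpha ->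
    generating_coeffs alpha varpi ->
    unconditionally_stable alpha d1 d2 dalpha varpi /\
    forall (a b T : R) (s : R -> R -> R) (phi : R -> R) (u : R -> R -> R),
      a < b -> 0 < T ->
      solves_ibvp alpha d1 d2 dalpha a b T s phi u ->
      consistent alpha d1 d2 dalpha a b T varpi u ->
      second_order_convergent alpha d1 d2 dalpha a b T varpi s phi u.
Proof.
intros alpha d1 d2 dalpha varpi Ha Hd1 Hd2 Hda Hv.
split; [now apply mode_unconditionally_stable|].
intros a b T s phi u Hab HT Hu Hcons.
now apply scheme_second_order_convergent; try apply Rlt_le.
Qed.
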